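(* If $M \subseteq \mathbb{R}^p$ is a Borel set satisfying Condition A with matrix $\bar C = C$, then $$\inf_{t \in \overline{\mathbb{R}}^p} P_t(\hat u \in M) = \min_{d \in \{-1,1\}^p} P(\hat u^d \in M),$$ where $\hat u^d \sim N(-C^{-1}\Lambda d,\ \sigma^2C^{-1})$.
   Context: $C$ is a real symmetric positive definite $p \times p$ matrix, $\lambda = (\lambda_1,\dots,\lambda_p)' \in [0,\infty)^p$, $\Lambda = \mathrm{diag}(\lambda)$, $W \sim N(0,\sigma^2C)$ with $\sigma^2$ finite, and $\overline{\mathbb{R}} = \mathbb{R}\cup\{-\infty,\infty\}$. For $t \in \overline{\mathbb{R}}^p$, $\hat u$ is the unique minimizer over $u \in \mathbb{R}^p$ of $$Q(u) = u'Cu - 2W'u + 2\sum_{j=1}^p\lambda_j\left[\mathbf{1}_{\{t_j\in\mathbb{R}\}}(|t_j+u_j| - |t_j|) + \mathbf{1}_{\{|t_j|=\infty\}}\mathrm{sgn}(t_j)u_j\right],$$ and $P_t(\hat u \in M)$ denotes the probability that this minimizer lies in $M$ for the given $t$. For $d\in\{-1,1\}^p$, $\hat u^d$ is the unique minimizer of $Q^d(u) = u'Cu - 2W'u + 2\sum_{j=1}^p\lambda_jd_ju_j$. For $m \in \mathbb{R}^p$, $d \in \{-1,1\}^p$ and $\bar C \in \mathbb{R}^{p\times p}$ let $A^d_{\bar C}(m) = \bigcap_{j=1}^p\{z \in \mathbb{R}^p : d_j(\bar Cm)_j \le d_j(\bar Cz)_j,\ d_jz_j \le 0\}$. A set $M\subseteq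 \mathbb{R}^p$ satisfies Condition A with matrix $\bar C$ if $A^d_{\bar C}(m) \subseteq M$ for all $d \in \{-1,1\}^p$ and all $m \in M$. *)

(* Defs.v *)
From HB Require Import structures.
From mathcomp Require Export all_boot all_order all_algebra.
From mathcomp Require Export all_classical all_reals all_analysis.
Export Order.TTheory GRing.Theory Num.Theory.
Export numFieldNormedType.Exports.

#[export] Set Implicit Arguments.
#[export] Unset Strict Implicit.
#[export] Unset Printing Implicit Defensive.

Open Scope classical_set_scope.
Open Scope ring_scope.

Definition borel_cV (R : realType) (p : nat) :=
  g_sigma_algebraType (@open 'cV[R]_p).

Definition posdef (R : realType) (p : nat) (C : 'M[R]_p) : Prop :=
  C^T = C /\ forall x : 'cV[R]_p, x != 0 -> 0 < (x^T *m C *m x) 0 0.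

(* N(m, v) on the real line, parametrized by its variance. The degenerate case
   has to be split off: [normal_prob m s] takes the standard deviation s, and
   for s = 0 it is the uniform law on [0, 1], not the point mass at m. *)
Definition normal_law (R : realType) (m v : R) (B : set R) : \bar R :=
  if v == 0 then \d_m B else normal_prob m (Num.sqrt v) B.

(* X is a random vector with law N(mu, Sigma), Sigma possibly singular: every
   linear form a'X is univariate normal N(a'mu, a'Sigma a). *)
Definition gaussian_vector (R : realType) (p : nat) (d : measure_display)
    (T : measurableType d) (P : probability T R) (X : T -> 'cV[R]_p)
    (mu : 'cV[R]_p) (Sigma : 'M[R]_p) : Prop :=
  measurable_fun [set: T] (X : T -> borel_cV R p) /\
  forall (a : 'cV[R]_p) (B : set R), measurable B ->
    P [set w | B ((a^T *m X w) 0 0)] =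
    normal_law ((a^T *m mu) 0 0) ((a^T *m Sigma *m a) 0 0) B.

(* {-1,1}^p is indexed by {ffun 'I_p -> bool}, with d_j = (-1) ^+ d j. *)
Definition sign_vec (R : realType) (p : nat) (d : {ffun 'I_p -> bool}) :
  'cV[R]_p := \col_j (-1) ^+ d j.
Arguments sign_vec : clear implicits.

(* The bracketed penalty term of Q for one coordinate. *)
Definition penalty (R : realType) (t : \bar R) (u : R) : R :=
  match t with
  | r%:E => `|r + u| - `|r|
  | +oo%E => u
  | -oo%E => - u
  end.

Definition Qobj (R : realType) (p : nat) (C : 'M[R]_p) (lam W : 'cV[R]_p)
    (t : 'cV[\bar R]_p) (u : 'cV[R]_p) : R :=
  (u^T *m C *m u) 0 0 - 2 * (W^T *m u) 0 0
    + 2 * \sum_j lam j 0 * penalty (t j 0) (u j 0).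

Definition Qsign (R : realType) (p : nat) (C : 'M[R]_p) (lam W : 'cV[R]_p)
    (d : {ffun 'I_p -> bool}) (u : 'cV[R]_p) : R :=
  (u^T *m C *m u) 0 0 - 2 * (W^T *m u) 0 0
    + 2 * \sum_j lam j 0 * sign_vec R p d j 0 * u j 0.

(* A minimizer of f, with junk value 0 if there is none. For C positive definite
   [Qobj C lam W t] and [Qsign C lam W d] are strictly convex and coercive, so
   that their minimizers exist and are unique. *)
Definition argmin (R : realType) (p : nat) (f : 'cV[R]_p -> R) : 'cV[R]_p :=
  xget 0 [set u | forall v, f u <= f v].

Definition uhat (R : realType) (p : nat) (C : 'M[R]_p) (lam W : 'cV[R]_p)
  (t : 'cV[\bar R]_p) : 'cV[R]_p := argmin (Qobj C lam W t).

Definition uhat_sign (R : realType) (p : nat) (C : 'M[R]_p) (lam W : 'cV[R]_p)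
  (d : {ffun 'I_p -> bool}) : 'cV[R]_p := argmin (Qsign C lam W d).

Definition Aset (R : realType) (p : nat) (Cbar : 'M[R]_p)
    (d : {ffun 'I_p -> bool}) (m : 'cV[R]_p) : set 'cV[R]_p :=
  \bigcap_(j in [set: 'I_p]) [set z : 'cV[R]_p |
    sign_vec R p d j 0 * (Cbar *m m) j 0 <= sign_vec R p d j 0 * (Cbar *m z) j 0
    /\ sign_vec R p d j 0 * z j 0 <= 0].

Definition conditionA (R : realType) (p : nat) (Cbar : 'M[R]_p)
    (M : set 'cV[R]_p) : Prop :=
  forall (d : {ffun 'I_p -> bool}) (m : 'cV[R]_p), M m -> Aset Cbar d m `<=` M.

(* Main.v *)
From HB Require Import structures.
Require Import Defs.
From mathcomp Require Import measurable_realfun ring lra.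

(** The theorem rests on an inclusion of events that holds for every value of
    the noise W. For t given, let d_j be the sign of t_j (1 if t_j = 0), let u be
    the minimizer of Q for t, and let m be the minimizer of Q^d. The claim is that m in M
    implies u in M ([uhat_sign_coverage]).

    Stationarity of m reads (Cm)_j = W_j - lambda_j d_j
    ([uhat_sign_stationary]), because the penalty of Q^d is linear. The
    penalty of Q is 1-Lipschitz in each coordinate, which gives
    d_j (Cu)_j >= d_j (Cm)_j ([uhat_gradient_ge]). So u would belong to
    A^d(m), were it not for the coordinates in which d_j u_j > 0. In such a
    coordinate t_j + u_j lies strictly on the side of t_j, the penalty of Q has
    slope d_j there, and (Cu)_j = (Cm)_j ([uhat_gradient_eq]). Since equality
    holds, the sign d_j may be reversed in these coordinates without spoiling
    the first inequality that defines A, and after the reversal the second one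
    holds as well: u lies in A^d'(m) for the modified sign vector d'
    ([uhat_in_Aset]), and Condition A puts u into M.

    Monotonicity of P then bounds every coverage probability below by one of
    the terms of the minimum. Conversely each such term is itself a coverage
    probability, as Q for t = (d_1 oo, ..., d_p oo) is Q^d ([uhat_infinite]).

    Two facts from analysis support this. The minimizer of Q exists, by
    compactness and the bound x'Cx >= c |x|^2 ([posdef_elliptic]). It depends
    on W in a Lipschitz way ([uhat_lipschitz]), so that the events are
    measurable. The law of the minimizer of Q^d follows from its closed form
    C^-1 W - C^-1 Lambda d, an affine image of a Gaussian vector
    ([gaussian_vector_affine]). *)

(** * Continuity *)

Lemma continuous_mull (R : realType) (T : topologicalType) (a : R)
    (f : T -> R) :
  continuous f -> continuous (fun x => a * f x).
Proof. by move=> fc x; apply: cvgMl_tmp; exact: fc. Qed.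

Lemma continuous_add (R : realType) (T : topologicalType) (f g : T -> R) :
  continuous f -> continuous g -> continuous (fun x => f x + g x).
Proof. by move=> fc gc x; apply: (@cvgD _ R^o); [exact: fc|exact: gc]. Qed.

Lemma lipschitz_bound_continuous (R : realType) (U V : normedModType R)
    (f : U -> V) (L : R) :
  (forall x y, `|f x - f y| <= L * `|x - y|) -> continuous f.
Proof.
move=> fL x; apply/cvgrPdist_le => e e0; near=> y.
have L1 : 0 < `|L| + 1 by rewrite ltr_wpDl.
apply: (le_trans (fL x y)); apply: (@le_trans _ _ ((`|L| + 1) * `|x - y|)).
  by rewrite ler_wpM2r// (le_trans (ler_norm L))// lerDl.
rewrite mulrC -ler_pdivlMr//.
near: y; apply: cvgr_dist_le => //; exact: divr_gt0.
Unshelve. all: by end_near. Qed.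

(** * Inner product and positive definite matrices *)

Section Vectors.
Variables (R : realType) (p : nat).
Implicit Types (x y z : 'cV[R]_p) (C : 'M[R]_p).

Definition dotv x y : R := (x^T *m y) 0 0.

Lemma dotvE x y : dotv x y = \sum_j x j 0 * y j 0.
Proof. by rewrite /dotv !mxE; apply: eq_bigr => j _; rewrite !mxE. Qed.

Lemma dotvC x y : dotv x y = dotv y x.
Proof. by rewrite !dotvE; apply: eq_bigr => j _; rewrite mulrC. Qed.

Lemma dotvDl x y z : dotv (x + y) z = dotv x z + dotv y z.
Proof. by rewrite /dotv linearD mulmxDl mxE. Qed.

Lemma dotvDr x y z : dotv z (x + y) = dotv z x + dotv z y.
Proof. by rewrite /dotv mulmxDr mxE. Qed.

Lemma dotvZl (a : R) x y : dotv (a *: x) y = a * dotv x y.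
Proof. by rewrite /dotv linearZ -scalemxAl mxE. Qed.

Lemma dotvZr (a : R) x y : dotv x (a *: y) = a * dotv x y.
Proof. by rewrite dotvC dotvZl dotvC. Qed.

Lemma dotvNl x y : dotv (- x) y = - dotv x y.
Proof. by rewrite -scaleN1r dotvZl mulN1r. Qed.

Lemma dotvNr x y : dotv x (- y) = - dotv x y.
Proof. by rewrite dotvC dotvNl dotvC. Qed.

Lemma dotv_delta x j : dotv (delta_mx j 0) x = x j 0.
Proof.
rewrite dotvE (bigD1 j)//= big1 ?addr0 => [|i ij]; first by rewrite mxE !eqxx mul1r.
by rewrite mxE (negbTE ij) mul0r.
Qed.

Lemma dotv_mulmxr C x y : dotv x (C *m y) = dotv (C^T *m x) y.
Proof. by rewrite /dotv trmx_mul trmxK mulmxA. Qed.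

Lemma cV_norm_le x (r : R) : 0 <= r -> (`|x| <= r) <-> forall j, `|x j 0| <= r.
Proof.
move=> r0; rewrite {1}/Num.Def.normr /= mx_normrE; split.
  by move=> /bigmax_leP[_ h] j; exact: (h (j, 0)).
by move=> h; apply/bigmax_leP; split=> // -[i j] _; rewrite /= ord1.
Qed.

Lemma cV_coord_le x j : `|x j 0| <= `|x|.
Proof. by have /(_ (lexx _)) /(_ j) := (@cV_norm_le x _ (normr_ge0 x)).1. Qed.

Lemma dotv_norm_le x y : `|dotv x y| <= p%:R * `|x| * `|y|.
Proof.
rewrite dotvE (le_trans (ler_norm_sum _ _ _))//.
have -> : p%:R * `|x| * `|y| = \sum_(j < p) `|x| * `|y|.
  by rewrite sumr_const card_ord mulr_natl mulrnAl.
by apply: ler_sum => j _; rewrite normrM ler_pM// cV_coord_le.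
Qed.

(** Transposition is continuous and carries the compactness of boxes of row
    vectors, an instance of the Tychonoff theorem, over to columns. *)
Lemma cV_ball_compact (r : R) : compact [set x : 'cV[R]_p | `|x| <= r].
Proof.
have [r0|r0] := ltP r 0.
  rewrite (_ : [set _ | _] = set0); first exact: compact0.
  by apply/seteqP; split=> x //= xr; move: (le_lt_trans xr r0); rewrite normr_lt0.
have tr_cont : continuous (fun v : 'rV[R]_p => v^T : 'cV[R]_p).
  move=> v A [B Bv BA]; exists (fun i j => B j i) => //.
    by move=> i j; have := Bv j i; rewrite mxE.
  by move=> w wB; apply: BA => i j; rewrite mxE; exact: wB.
rewrite (_ : [set _ | _] = (fun v : 'rV[R]_p => v^T : 'cV[R]_p) @`
    [set v : 'rV[R]_p | forall j, `[(- r), r]%classic (v ord0 j)]).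
  apply: continuous_compact; first exact: continuous_subspaceT.
  apply: (@rV_compact R p (fun=> `[(- r), r]%classic)) => _.
  exact: segment_compact.
apply/seteqP; split=> [x /= /(cV_norm_le _ r0) xr|_ [v vr <-]/=].
  exists x^T; last by rewrite trmxK.
  by move=> j /=; rewrite mxE in_itv/= -ler_norml.
apply/(cV_norm_le _ r0) => j; rewrite mxE ler_norml.
by have := vr j; rewrite /= in_itv.
Qed.

Lemma sum_continuous_cV (F : 'I_p -> 'cV[R]_p -> R) :
  (forall j, continuous (F j)) -> continuous (fun x => \sum_j F j x).
Proof.
move=> Fc; apply: continuous_big => //; exact: add_continuous.
Qed.

Lemma dotv_continuous (f g : 'cV[R]_p -> 'cV[R]_p) :
  (forall j, continuous (fun x => f x j 0)) ->
  (forall j, continuous (fun x => g x j 0)) ->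
  continuous (fun x => dotv (f x) (g x)).
Proof.
move=> fc gc.
under [X in continuous X]eq_fun do rewrite dotvE.
by apply: sum_continuous_cV => j x; apply: continuousM; [exact: fc|exact: gc].
Qed.

Lemma mulmx_coord_continuous C j : continuous (fun x => (C *m x) j 0).
Proof.
under [X in continuous X]eq_fun do rewrite mxE.
apply: sum_continuous_cV => k x; apply: continuousM; first exact: cst_continuous.
exact: coord_continuous.
Qed.

Lemma quad_continuous C : continuous (fun x => dotv x (C *m x)).
Proof.
apply: dotv_continuous => j; first exact: coord_continuous.
exact: mulmx_coord_continuous.
Qed.

Lemma posdef_gt0 C x : posdef C -> x != 0 -> 0 < dotv x (C *m x).
Proof. by move=> [_ +] x0 => /(_ x x0); rewrite /dotv mulmxA. Qed.

(** The quadratic form attains its minimum on the unit sphere, which is compact;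
    that minimum is positive, and homogeneity extends the bound to all x. *)
Lemma posdef_elliptic C : posdef C ->
  exists2 c, 0 < c & forall x, c * `|x| ^+ 2 <= dotv x (C *m x).
Proof.
move=> Cpd; pose S := [set x : 'cV[R]_p | `|x| = 1].
have normS x : x != 0 -> S (`|x|^-1 *: x).
  by move=> x0; rewrite /S /= normrZ normfV normr_id mulVf// normr_eq0.
have [S0|S0] := pselect (S !=set0); last first.
  exists 1 => // x; have [->|x0] := eqVneq x 0.
    by rewrite normr0 expr0n mulr0 mulmx0 /dotv mulmx0 mxE.
  by exfalso; apply: S0; eexists; exact: normS x0.
have cS : compact S.
  apply: (subclosed_compact _ (@cV_ball_compact 1)); last by move=> x /= ->.
  have -> : S = (fun x => `|x|) @^-1` [set y : R | y = 1] by [].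
  by apply: preimage_closed => [x _|]; [exact: norm_continuous|exact: closed_eq].
have [c cS1 cmin] := compact_EVT_min S0 cS
  (continuous_subspaceT (@quad_continuous C)).
have c0 : c != 0.
  move: cS1; rewrite inE /S /=; case: eqVneq => // -> /eqP.
  by rewrite normr0 eq_sym oner_eq0.
exists (dotv c (C *m c)); first exact: posdef_gt0.
move=> x; have [->|x0] := eqVneq x 0.
  by rewrite normr0 expr0n mulr0 mulmx0 /dotv mulmx0 mxE.
have := cmin _ (mem_set (normS x x0)).
rewrite -scalemxAr dotvZl dotvZr mulrA -expr2 exprVn => h.
by rewrite mulrC -ler_pdivlMl// exprn_gt0// normr_gt0.
Qed.

Lemma posdef_unitmx C : posdef C -> C \in unitmx.
Proof.
move=> Cpd; rewrite -row_free_unit; apply: inj_row_free => v vC.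
apply/eqP/negPn/negP => v0; have vT0 : v^T != 0 by rewrite trmx_eq0.
by have := posdef_gt0 Cpd vT0; rewrite dotv_mulmxr -[C^T *m _]trmxK
  trmx_mul !trmxK vC trmx0 /dotv trmx0 mul0mx mxE ltxx.
Qed.

End Vectors.

(** * The penalty of one coordinate *)

Section Penalty.
Variable R : realType.
Implicit Types (t : \bar R) (u v h s : R).

Lemma penalty0 t : penalty t 0 = 0 :> R.
Proof. by case: t => [r||] /=; rewrite ?oppr0// addr0 subrr. Qed.

Lemma penalty_lipschitz t u v : `|penalty t u - penalty t v| <= `|u - v|.
Proof.
case: t => [r||] //=; last by rewrite -opprB normrN opprK addrC.
have -> : `|r + u| - `|r| - (`|r + v| - `|r|) = `|r + u| - `|r + v| by ring.
by rewrite (le_trans (ler_dist_dist _ _))// opprD addrACA subrr add0r.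
Qed.

Lemma penalty_continuous t : continuous (penalty t : R -> R).
Proof.
apply: (@lipschitz_bound_continuous _ R^o R^o _ 1) => u v.
by rewrite mul1r penalty_lipschitz.
Qed.

Lemma penalty_convex t u h s : 0 <= s <= 1 ->
  penalty t (u + s * h) - penalty t u <= s * (penalty t (u + h) - penalty t u).
Proof.
move=> /andP[s0 s1]; case: t => [r||] /=; try lra.
have -> : r + (u + s * h) = (1 - s) * (r + u) + s * (r + (u + h)) by ring.
have : `|(1 - s) * (r + u) + s * (r + (u + h))| <=
    (1 - s) * `|r + u| + s * `|r + (u + h)|.
  rewrite (le_trans (ler_normD _ _))// !normrM (ger0_norm s0).
  by rewrite (@ger0_norm _ (1 - s)) ?subr_ge0.
by move=> ?; lra.
Qed.

End Penalty.

(** * Existence, stationarity and stability of the minimizer *)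

Section Minimizer.
Variables (R : realType) (p : nat) (C : 'M[R]_p) (lam : 'cV[R]_p).
Hypotheses (C_posdef : posdef C) (lam_ge0 : forall j, 0 <= lam j 0).
Implicit Types (W u v h : 'cV[R]_p) (t : 'cV[\bar R]_p).

Lemma QobjE W t u : Qobj C lam W t u = dotv u (C *m u) - 2 * dotv W u
  + 2 * \sum_j lam j 0 * penalty (t j 0) (u j 0).
Proof. by rewrite /Qobj /dotv mulmxA. Qed.

(** The difference splits into a quadratic part, which is of second order in h,
    and a first-order part; the variational inequality keeps only the latter. *)
Lemma Qobj_increment W t u h : Qobj C lam W t (u + h) - Qobj C lam W t u =
  dotv h (C *m h) + 2 * (dotv h (C *m u - W) +
    \sum_j lam j 0 * (penalty (t j 0) (u j 0 + h j 0) - penalty (t j 0) (u j 0))).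
Proof.
have -> : \sum_j lam j 0 *
    (penalty (t j 0) (u j 0 + h j 0) - penalty (t j 0) (u j 0)) =
    \sum_j lam j 0 * penalty (t j 0) ((u + h) j 0) -
    \sum_j lam j 0 * penalty (t j 0) (u j 0).
  by rewrite -sumrB; apply: eq_bigr => j _; rewrite mulrBr mxE.
have CT : C^T = C by case: C_posdef.
have Cuh : dotv u (C *m h) = dotv h (C *m u).
  by rewrite dotv_mulmxr CT dotvC.
rewrite !QobjE mulmxDr !(dotvDl, dotvDr, dotvNr) Cuh (dotvC W h); ring.
Qed.

Lemma Qobj_continuous W t : continuous (Qobj C lam W t).
Proof.
have -> : Qobj C lam W t = (fun u => dotv u (C *m u) + -2 * dotv W u
    + 2 * \sum_j lam j 0 * penalty (t j 0) (u j 0)).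
  by apply/funext => u; rewrite QobjE mulNr.
have cdot : continuous (dotv W).
  by apply: dotv_continuous => j; [exact: cst_continuous|exact: coord_continuous].
have cpen : continuous (fun u : 'cV[R]_p =>
    \sum_j lam j 0 * penalty (t j 0) (u j 0)).
  apply: sum_continuous_cV => j; apply: continuous_mull => y.
  apply: (@continuous_comp _ _ _ (fun z : 'cV[R]_p => z j 0)).
    exact: coord_continuous.
  exact: penalty_continuous.
apply: continuous_add; last exact: continuous_mull.
by apply: continuous_add; [exact: quad_continuous|exact: continuous_mull].
Qed.

(** Ellipticity beats the linear terms: outside the ball of radius K / c the
    objective is at least Q(0) = 0, so a minimum over that compact ball is a
    minimum over the whole space. *)
Lemma Qobj_has_min W t : exists u, forall v, Qobj C lam W t u <= Qobj C lam W t v.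
Proof.
have [c c0 Cc] := posdef_elliptic C_posdef.
pose K := 2 * (p%:R * `|W|) + 2 * \sum_j lam j 0.
have K0 : 0 <= K by rewrite addr_ge0// mulr_ge0// ?mulr_ge0// sumr_ge0.
pose B := [set x : 'cV[R]_p | `|x| <= K / c].
have B0 : B 0 by rewrite /B /= normr0 divr_ge0// ltW.
have [u _ umin] := compact_EVT_min (ex_intro _ 0 B0) (@cV_ball_compact R p _)
  (continuous_subspaceT (@Qobj_continuous W t)).
exists u => v; have [vB|vB] := leP `|v| (K / c).
  by apply: umin; rewrite inE.
apply: (le_trans (umin _ (mem_set B0))).
have -> : Qobj C lam W t 0 = 0.
  rewrite QobjE mulmx0 !dotvE !big1 ?mulr0 ?subr0 ?addr0// => j _.
  - by rewrite mxE penalty0 mulr0.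
  - by rewrite mxE mulr0.
  - by rewrite mxE mul0r.
have pen_ge : - (\sum_j lam j 0 * `|v|) <=
    \sum_j lam j 0 * penalty (t j 0) (v j 0).
  rewrite -sumrN; apply: ler_sum => j _; rewrite -mulrN ler_wpM2l//.
  have := penalty_lipschitz (t j 0) (v j 0) 0.
  rewrite penalty0 !subr0 ler_norml => /andP[+ _]; apply: le_trans.
  by rewrite lerN2 cV_coord_le.
rewrite -mulr_suml in pen_ge.
have := dotv_norm_le W v; rewrite ler_norml => /andP[_ Wv].
have : 0 <= `|v| * (c * `|v| - K).
  by rewrite mulr_ge0// subr_ge0 mulrC -ler_pdivrMr// ltW.
rewrite /K QobjE; have := Cc v; rewrite expr2; lra.
Qed.

Lemma uhat_min W t v : Qobj C lam W t (uhat C lam W t) <= Qobj C lam W t v.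
Proof.
have [u uP] := Qobj_has_min W t; rewrite /uhat /argmin.
by case: xgetP => [y _ /(_ v)//|/(_ u)]; case.
Qed.

(** By convexity of the penalty, moving from the minimizer by s h costs at most
    s times the first-order part plus s^2 times h'Ch; dividing by s and letting
    s tend to 0 leaves the first-order part. *)
Lemma uhat_variational W t h : 0 <= dotv h (C *m uhat C lam W t - W) +
  \sum_j lam j 0 * (penalty (t j 0) (uhat C lam W t j 0 + h j 0)
                    - penalty (t j 0) (uhat C lam W t j 0)).
Proof.
set u := uhat C lam W t; set g := (X in 0 <= X).
have gs s : 0 < s <= 1 -> 0 <= s * dotv h (C *m h) + 2 * g.
  move=> /andP[s0 s1]; rewrite -(pmulr_rge0 _ s0).
  have := uhat_min W t (u + s *: h); rewrite -subr_ge0 Qobj_increment -/u.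
  move=> /le_trans; apply.
  rewrite -scalemxAr !(dotvZl, dotvZr).
  have : \sum_j lam j 0 *
      (penalty (t j 0) (u j 0 + (s *: h) j 0) - penalty (t j 0) (u j 0)) <=
      s * \sum_j lam j 0 *
      (penalty (t j 0) (u j 0 + h j 0) - penalty (t j 0) (u j 0)).
    rewrite mulr_sumr; apply: ler_sum => j _; rewrite mulrCA ler_wpM2l//.
    by rewrite mxE penalty_convex// ltW.
  rewrite /g; lra.
rewrite leNgt; apply/negP => g0.
(* If g < 0, the bound fails at s = -g / h'Ch when this is at most 1, and at
   s = 1 otherwise. *)
have [q0|q0] := leP (dotv h (C *m h)) (- g).
  by have := gs 1; rewrite ltr01 lexx mul1r => /(_ isT); lra.
have q_gt0 : 0 < dotv h (C *m h) by lra.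
have := gs (- g / dotv h (C *m h)); rewrite divfK ?gt_eqF// divr_gt0 ?oppr_gt0//.
by rewrite ler_pdivrMr// mul1r (ltW q0) => /(_ isT); lra.
Qed.

(** The variational inequality along a coordinate axis plays the part of the
    subdifferential conditions: suitable steps a yield the bound on the gradient
    and its value where the penalty is smooth. *)
Lemma uhat_kkt W t j (a : R) : let u := uhat C lam W t in
  0 <= a * ((C *m u) j 0 - W j 0) +
    lam j 0 * (penalty (t j 0) (u j 0 + a) - penalty (t j 0) (u j 0)).
Proof.
have := uhat_variational W t (a *: delta_mx j 0) => /=; set u := uhat C lam W t.
have hE i : (a *: delta_mx j 0 : 'cV[R]_p) i 0 = a * (i == j)%:R.
  by rewrite !mxE eqxx andbT.
have gE : (C *m u - W) j 0 = (C *m u) j 0 - W j 0 by rewrite mxE [X in _ + X]mxE.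
rewrite dotvZl dotv_delta gE (bigD1 j)//= big1 => [|i ij].
  by rewrite hE eqxx mulr1 addr0.
by rewrite hE (negbTE ij) mulr0 addr0 subrr mulr0.
Qed.

(** Testing the variational inequality of each minimizer with the other one and
    adding up cancels the penalties and leaves, for x the difference of the
    minimizers, x'Cx <= x'(W1 - W2). *)
Lemma uhat_lipschitz t : exists L, forall W1 W2,
  `|uhat C lam W1 t - uhat C lam W2 t| <= L * `|W1 - W2|.
Proof.
have [c c0 Cc] := posdef_elliptic C_posdef.
exists (p%:R / c) => W1 W2.
set u1 := uhat C lam W1 t; set u2 := uhat C lam W2 t.
have dE (x y : 'cV[R]_p) j : x j 0 + (y - x) j 0 = y j 0.
  by rewrite !mxE; ring.
have := uhat_variational W1 t (u2 - u1); have := uhat_variational W2 t (u1 - u2).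
rewrite -/u1 -/u2 !(dotvDl, dotvNl, dotvDr, dotvNr).
under eq_bigr do rewrite dE.
under [X in _ -> 0 <= _ + X -> _]eq_bigr do rewrite dE.
set s2 := \sum_j _; set s1 := \sum_j _ => h2 h1.
have s12 : s1 = - s2 by rewrite /s1 /s2 -sumrN; apply: eq_bigr => j _; ring.
have key : c * `|u1 - u2| ^+ 2 <= dotv (u1 - u2) (W1 - W2).
  apply: (le_trans (Cc _)); rewrite mulmxBr !(dotvDl, dotvNl, dotvDr, dotvNr).
  by move: h1 h2; rewrite s12; lra.
have := dotv_norm_le (u1 - u2) (W1 - W2); rewrite ler_norml => /andP[_ ub].
have [->|n0] := eqVneq `|u1 - u2| 0.
  by rewrite mulr_ge0// divr_ge0// ltW.
have n_gt0 : 0 < `|u1 - u2| by rewrite lt0r n0 normr_ge0.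
rewrite mulrAC ler_pdivlMr// -(ler_pM2l n_gt0).
move: (le_trans key ub); rewrite expr2; lra.
Qed.

Lemma uhat_continuous t : continuous (fun W => uhat C lam W t).
Proof.
by have [L uL] := uhat_lipschitz t; exact: lipschitz_bound_continuous uL.
Qed.

End Minimizer.

(** On the side of t the penalty has no kink: the absolute value opens there
    with the sign of t. *)
Lemma penalty_outward (R : realType) (t : \bar R) (u : R) :
  0 <= (-1) ^+ (t < 0)%E * u -> penalty t u = (-1) ^+ (t < 0)%E * u.
Proof.
case: t => [r||] /=; rewrite ?lte_fin ?ltNyr ?expr0 ?expr1 ?mul1r ?mulN1r//.
have [r0|r0] := ltP r 0; rewrite ?expr0 ?expr1 ?mul1r ?mulN1r => u0.
  by rewrite !ltr0_norm; lra.
by rewrite !ger0_norm; lra.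
Qed.

(** * The minimizer for t lies in a set A of the minimizer for the sign of t *)

Section Coverage.
Variables (R : realType) (p : nat) (C : 'M[R]_p) (lam : 'cV[R]_p).
Hypotheses (C_posdef : posdef C) (lam_ge0 : forall j, 0 <= lam j 0).
Implicit Types (W : 'cV[R]_p) (t : 'cV[\bar R]_p) (d : {ffun 'I_p -> bool}).

Definition infinite_vec d : 'cV[\bar R]_p :=
  \col_j (if d j then -oo else +oo)%E.

Lemma sign_vecE d j : sign_vec R p d j 0 = (-1) ^+ d j.
Proof. by rewrite mxE. Qed.

Lemma uhat_infinite W d :
  uhat C lam W (infinite_vec d) = uhat_sign C lam W d.
Proof.
rewrite /uhat /uhat_sign; congr argmin; apply/funext => u.
congr (_ + _ * _); apply: eq_bigr => j _; rewrite sign_vecE mxE -mulrA.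
by case: (d j); rewrite /= ?expr0 ?expr1 ?mulN1r ?mul1r.
Qed.

Lemma uhat_sign_stationary W d j :
  (C *m uhat_sign C lam W d) j 0 = W j 0 - lam j 0 * (-1) ^+ d j.
Proof.
have := uhat_kkt C_posdef lam_ge0 W (infinite_vec d) j 1.
have := uhat_kkt C_posdef lam_ge0 W (infinite_vec d) j (-1).
rewrite /= uhat_infinite !mxE; set g := \sum_i _.
by case: (d j) => /=; rewrite ?expr0 ?expr1; lra.
Qed.

Lemma uhat_sign_closed_form W d : uhat_sign C lam W d =
  invmx C *m W - invmx C *m diag_mx lam^T *m sign_vec R p d.
Proof.
apply: (can_inj (mulKmx (posdef_unitmx C_posdef))).
rewrite mulmxBr -[in X in _ - X]mulmxA !mulKVmx ?posdef_unitmx//.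
apply/colP => j; rewrite uhat_sign_stationary [RHS]mxE [X in _ = _ + X]mxE.
by rewrite mul_diag_mx !mxE.
Qed.

(** Stationarity with a step of length 1 in the direction of the sign of t_j,
    where the Lipschitz bound controls the change of the penalty. *)
Lemma uhat_gradient_ge W t j :
  - lam j 0 <= (-1) ^+ (t j 0%R < 0)%E * ((C *m uhat C lam W t) j 0 - W j 0).
Proof.
have := uhat_kkt C_posdef lam_ge0 W t j ((-1) ^+ (t j 0%R < 0)%E).
set s := (-1) ^+ _; set u := uhat _ _ _ _ => /=.
have := penalty_lipschitz (t j 0) (u j 0 + s) (u j 0).
rewrite [u j 0 + s]addrC addrK normr_sign => /(le_trans (ler_norm _)).
by move=> /(ler_wpM2l (lam_ge0 j)); lra.
Qed.

(** If u_j points away from 0 on the side of t_j, then the step back to 0 stays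
    on the smooth side, so the gradient is determined. *)
Lemma uhat_gradient_eq W t j : let s := (-1) ^+ (t j 0%R < 0)%E in
  0 < s * uhat C lam W t j 0 ->
  s * ((C *m uhat C lam W t) j 0 - W j 0) = - lam j 0.
Proof.
move=> s su; apply/eqP; rewrite eq_le uhat_gradient_ge andbT.
have := uhat_kkt C_posdef lam_ge0 W t j (- uhat C lam W t j 0).
rewrite /= subrr penalty0 penalty_outward ?(ltW su)// -/s.
set u := uhat _ _ _ _ in su *; set g := _ - W j 0 => h.
have ss : s * s = 1 by rewrite -expr2 sqrr_sign.
rewrite -(ler_pM2l su); have -> : s * u j 0 * (s * g) = u j 0 * g.
  by rewrite mulrACA ss mul1r.
by lra.
Qed.

(** The sign vector of t, reversed in the coordinates where the minimizer has
    the same sign as t. The value [true] encodes -1. *)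
Definition outward_flip W t : {ffun 'I_p -> bool} :=
  [ffun j => (t j 0%R < 0)%E (+)
    (0 < (-1) ^+ (t j 0%R < 0)%E * uhat C lam W t j 0)].

(** Where the sign is kept, the gradient bound gives the first inequality of A
    and the sign of u_j the second. Where it is reversed, the gradients of the
    two problems agree, so the first inequality survives the reversal, which
    makes the second one true. *)
Lemma uhat_in_Aset W t :
  Aset C (outward_flip W t)
    (uhat_sign C lam W [ffun j => (t j 0%R < 0)%E]) (uhat C lam W t).
Proof.
move=> j _ /=; rewrite sign_vecE uhat_sign_stationary !ffunE signr_addb.
set s := (-1) ^+ (t j 0%R < 0)%E.
have ss : s * s = 1 by rewrite -expr2 sqrr_sign.
have [su|su] := ltP 0 (s * uhat C lam W t j 0).
  have := uhat_gradient_eq su; rewrite -/s expr1 !mulrN1 !mulNr !mulrBr.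
  rewrite mulrCA ss mulr1 => h; split; last by lra.
  by rewrite lerN2; lra.
rewrite expr0 mulr1; split => //.
have := uhat_gradient_ge W t j; rewrite -/s !mulrBr mulrCA ss; lra.
Qed.

Lemma uhat_sign_coverage (M : set 'cV[R]_p) W t : conditionA C M ->
  M (uhat_sign C lam W [ffun j => (t j 0%R < 0)%E]) -> M (uhat C lam W t).
Proof. by move=> MA /MA; apply; exact: uhat_in_Aset. Qed.

End Coverage.

(** * Translation of normal laws *)

Section Law.
Local Open Scope ereal_scope.
Variable R : realType.

Let shift (c : R) : measurableTypeR R -> measurableTypeR R := fun x => (x + c)%R.
Lemma measurable_shift c : measurable_fun setT (shift c).
Proof. by apply: measurable_funD. Qed.

HB.instance Definition _ c :=
  isMeasurableFun.Build _ _ _ _ (shift c) (measurable_shift c).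

Lemma lebesgue_measure_shift (c : R) (A : set R) : measurable A ->
  pushforward lebesgue_measure (shift c) A = lebesgue_measure A.
Proof.
move=> mA; apply/esym/lebesgue_measure_unique => //= _ [[a b]] _ <-.
rewrite /pushforward.
rewrite (_ : shift c @^-1` _ = `](a - c)%R, (b - c)%R]%classic); last first.
  by apply/seteqP; split=> x; rewrite /shift /= !in_itv/= ltrBlDr lerBrDr.
rewrite !lebesgue_measure_itv/= !lte_fin ltrD2r.
by case: ifP => // _; rewrite -!EFinB; congr EFin; ring.
Qed.

(** Nonnegativity of v matters because the standard deviation [Num.sqrt v] is 0
    for negative v, where [normal_prob] is a fixed uniform law and is not moved
    by a translation of the mean. *)
Lemma normal_law_shift (m c v : R) (B : set R) : (0 <= v)%R -> measurable B ->
  normal_law m v [set x | B (x + c)%R] = normal_law (m + c) v B.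
Proof.
move=> v0 mB; rewrite /normal_law; case: eqVneq => [_|vn0].
  rewrite !diracE.
  suff -> : (m \in [set x | B (x + c)%R]) = ((m + c)%R \in B) by [].
  by apply/idP/idP; rewrite !inE.
have sn0 : (Num.sqrt v != 0)%R by rewrite gt_eqF// sqrtr_gt0 lt0r vn0.
rewrite /normal_prob.
transitivity (\int[lebesgue_measure]_(x in shift c @^-1` B)
    ((fun y => (normal_pdf (m + c) (Num.sqrt v) y)%:E) \o shift c) x).
  apply: eq_integral => x _ /=; rewrite !normal_pdfE// /normal_fun /shift.
  by rewrite opprD addrACA subrr addr0.
rewrite -ge0_integral_pushforward//=.
- apply: eq_measure_integral => A mA _; exact: lebesgue_measure_shift.
- apply/measurable_EFinP; apply: measurable_funTS; exact: measurable_normal_pdf.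
- by move=> y _; rewrite lee_fin normal_pdf_ge0.
Qed.

End Law.

(** * Images of random vectors *)

Lemma continuous_borel_measurable (R : realType) (p : nat)
    (disp : measure_display) (T : measurableType disp)
    (X : T -> 'cV[R]_p) (f : 'cV[R]_p -> 'cV[R]_p) :
  continuous f ->
  measurable_fun setT (X : T -> borel_cV R p) ->
  measurable_fun setT (f \o X : T -> borel_cV R p).
Proof.
move=> fc mX.
apply: (@measurability _ _ T (borel_cV R p) setT (f \o X)
  (@open 'cV[R]_p)) => //.
move=> _ [B oB <-].
rewrite (_ : _ `&` _ = setT `&` X @^-1` (f @^-1` B)) //.
apply: mX => //; apply: sub_sigma_algebra.
by move/continuousP: fc; exact.
Qed.

Lemma affine_continuous (R : realType) (p : nat) (A : 'M[R]_p) (b : 'cV[R]_p) :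
  continuous (fun x : 'cV[R]_p => A *m x + b).
Proof.
apply: (@lipschitz_bound_continuous _ _ _ _ (p%:R * `|A|)) => x y.
rewrite opprD addrACA subrr addr0 -mulmxBr.
have r0 : 0 <= p%:R * `|A| * `|x - y| by rewrite !mulr_ge0.
apply/(cV_norm_le _ r0) => i.
have -> : (A *m (x - y)) i 0 = dotv (row i A)^T (x - y).
  by rewrite mxE dotvE; apply: eq_bigr => j _; rewrite !mxE.
apply: (le_trans (dotv_norm_le _ _)); rewrite ler_wpM2r// ler_wpM2l//.
apply/(cV_norm_le _ (normr_ge0 _)) => j; rewrite !mxE.
rewrite [leRHS]/Num.Def.normr /= mx_normrE; exact: (le_bigmax _ _ (i, j)).
Qed.

(** A linear form of AX + b is a linear form of X up to a translation, so the
    univariate marginals are translates of those of X. *)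
Lemma gaussian_vector_affine (R : realType) (p : nat) (d : measure_display)
    (T : measurableType d) (P : probability T R) (X : T -> 'cV[R]_p)
    (mu : 'cV[R]_p) (Sigma A : 'M[R]_p) (b : 'cV[R]_p) :
  (forall a : 'cV[R]_p, 0 <= (a^T *m Sigma *m a) 0 0) ->
  gaussian_vector P X mu Sigma ->
  gaussian_vector P (fun w => A *m X w + b) (A *m mu + b) (A *m Sigma *m A^T).
Proof.
move=> Sigma_ge0 [mX lawX]; split.
  exact: (continuous_borel_measurable (@affine_continuous R p A b) mX).
move=> a B mB; pose c := (a^T *m b) 0 0.
have affE (x : 'cV[R]_p) :
    (a^T *m (A *m x + b)) 0 0 = ((A^T *m a)^T *m x) 0 0 + c.
  by rewrite mulmxDr mxE trmx_mul trmxK mulmxA.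
under [X in P X]eq_set do rewrite affE.
rewrite (lawX (A^T *m a) [set y | B (y + c)]); last first.
  have : measurable_fun setT (fun y : R => y + c) by exact: measurable_funD.
  by move=> /(_ measurableT B mB); rewrite setTI.
rewrite (normal_law_shift _ c (Sigma_ge0 (A^T *m a)) mB) -affE.
by rewrite trmx_mul trmxK !mulmxA.
Qed.

(** * Infimal coverage *)

Theorem theorem10 (R : realType) (p : nat) (C : 'M[R]_p) (lam : 'cV[R]_p)
    (sigma2 : R) (disp : measure_display) (T : measurableType disp)
    (P : probability T R) (W : T -> 'cV[R]_p) (M : set 'cV[R]_p)
    (C_posdef : posdef C)
    (lam_ge0 : forall j, 0 <= lam j 0)
    (sigma2_ge0 : 0 <= sigma2)
    (W_normal : gaussian_vector P W 0 (sigma2 *: C))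
    (M_borel : measurable (M : set (borel_cV R p)))
    (M_condA : conditionA C M) :
  ereal_inf [set P [set w | M (uhat C lam (W w) t)] | t in [set: 'cV[\bar R]_p]]
    = \big[mine/+oo%E]_(d : {ffun 'I_p -> bool})
        P [set w | M (uhat_sign C lam (W w) d)]
  /\ (forall d : {ffun 'I_p -> bool},
       gaussian_vector P (fun w => uhat_sign C lam (W w) d)
         (- (invmx C *m diag_mx lam^T *m sign_vec R p d))
         (sigma2 *: invmx C)).
Proof.
have m_uhat t : measurable [set w | M (uhat C lam (W w) t)].
  have cu := uhat_continuous C_posdef lam_ge0 (t := t).
  have := continuous_borel_measurable cu W_normal.1.
  by move=> /(_ measurableT _ M_borel); rewrite setTI.
have signE d w : uhat_sign C lam (W w) d = uhat C lam (W w) (infinite_vec R d).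
  by rewrite uhat_infinite.
split.
  apply/eqP; rewrite eq_le; apply/andP; split.
    apply/bigmin_geP; split=> [|d _]; first exact: leey.
    apply: ereal_inf_lbound; exists (infinite_vec R d) => //.
    by under eq_set do rewrite -signE.
  apply: le_ereal_inf_tmp => _ [t _ <-].
  apply: (le_trans (bigmin_le _ [ffun j => (t j 0%R < 0)%E] _)).
  apply: le_measure; rewrite ?inE//.
    by under eq_set do rewrite signE; exact: m_uhat.
  by move=> w /=; exact: uhat_sign_coverage.
move=> d; have CT : C^T = C by case: C_posdef.
under eq_fun do rewrite uhat_sign_closed_form//.
have psd (a : 'cV[R]_p) : 0 <= (a^T *m (sigma2 *: C) *m a) 0 0.
  have [->|a0] := eqVneq a 0; first by rewrite mulmx0 mxE.
  rewrite -scalemxAr -scalemxAl mxE mulr_ge0//.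
  by case: C_posdef => _ /(_ _ a0)/ltW.
have varE : invmx C *m (sigma2 *: C) *m (invmx C)^T = sigma2 *: invmx C.
  by rewrite -scalemxAr mulVmx ?posdef_unitmx// -scalemxAl mul1mx trmx_inv CT.
have := gaussian_vector_affine (invmx C)
  (- (invmx C *m diag_mx lam^T *m sign_vec R p d)) psd W_normal.
by rewrite varE mulmx0 add0r.
Qed.
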